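(* Let $\Gamma$ be a finitely generated, residually finite group with finite generating set $X$. Then for every positive integer $n$, $$\log(\mathrm{G}_{\Gamma,X}(n))\le \mathrm{s}_\Gamma(\mathrm{F}_{\Gamma,X}(2n))\,\log(\mathrm{F}_{\Gamma,X}(2n)).$$
   Context: $\|\cdot\|_X$ denotes word length with respect to $X$ and $B_{\Gamma,X}(n)=\{\gamma\in\Gamma:\|\gamma\|_X\le n\}$. $\mathrm{G}_{\Gamma,X}(n)$ is the cardinality of the smallest finite group $Q$ for which there exists a surjective homomorphism $\varphi:\Gamma\to Q$ whose restriction to $B_{\Gamma,X}(n)$ is injective. $\mathrm{s}_\Gamma(n)$ is the number of normal subgroups $\Delta\lhd\Gamma$ with $[\Gamma:\Delta]\le n$. $\mathrm{F}_{\Gamma,X}(n)$ is the smallest positive integer $N$ such that for every nontrivial $\gamma\in\Gamma$ with $\|\gamma\|_X\le n$ there is a normal subgroup of $\Gamma$ of finite index at most $N$ not containing $\gamma$. *)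

(* Defs.v *)
From mathcomp Require Import all_boot all_order all_algebra all_fingroup.
From mathcomp Require Import finmap.
From mathcomp Require Import all_classical all_reals all_analysis.

Set Implicit Arguments.
Unset Strict Implicit.
Unset Printing Implicit Defensive.

Local Open Scope classical_set_scope.
Local Open Scope card_scope.
Local Open Scope group_scope.

(* Arbitrary (possibly infinite) groups are MathComp's [groupType]s. *)

(* Minimum of a set of natural numbers; the value at the empty set is 0. *)
Definition least (P : set nat) : nat :=
  xget 0%N [set m | P m /\ forall k, P k -> (m <= k)%N].

Lemma leastP (P : set nat) :
  P !=set0 -> P (least P) /\ forall k, P k -> (least P <= k)%N.
Proof.
move=> [m0 Pm0]; rewrite /least; case: xgetP => [m _ //|/= noP]; exfalso.
have exP : exists m, `[< P m >] by exists m0; apply/asboolP.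
case: (ex_minnP exP) => m /asboolP Pm min_m; apply: (noP m); split=> // k Pk.
by apply: min_m; apply/asboolP.
Qed.

Section GroupDefs.
Variable G : groupType.
Implicit Types (X : {fset G}) (D : set G) (g : G) (n N : nat).

Definition is_word X (w : seq G) : Prop :=
  forall x, x \in w -> x \in X \/ x^-1 \in X.

Definition generates X : Prop :=
  forall g, exists w, is_word X w /\ \prod_(x <- w) x = g.

Definition word_length X g : nat :=
  least [set k | exists w, [/\ is_word X w, \prod_(x <- w) x = g & size w = k]].

Definition word_ball X n : set G := [set g | (word_length X g <= n)%N].

Definition normal_subgroup D : Prop :=
  group_closed [in D] /\ forall g x, D x -> D (x ^ g).

Definition left_cosets D : set (set G) :=
  [set [set g * d | d in D] | g in [set: G]].

Definition finite_index D : Prop := finite_set (left_cosets D).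

(* [G : D] is finite and at most N; `I_N is the set {0, ..., N - 1}. *)
Definition index_le D N : Prop := left_cosets D #<= `I_N.

Definition residually_finite : Prop :=
  forall g, g <> 1 -> exists D, [/\ normal_subgroup D, finite_index D & ~ D g].

(* The least order of a finite quotient of G into which the n-ball embeds. *)
Definition full_residual_growth X n : nat :=
  least [set m | exists (Q : finGroupType) (phi : {multiplicative G -> Q}),
    [/\ #|Q| = m, set_surj [set: G] [set: Q] phi
      & set_inj (word_ball X n) phi]].

(* [fset_set] of an infinite set is empty, but this family is finite when G is
   finitely generated. *)
Definition normal_growth n : nat :=
  #|` fset_set [set D : set G | normal_subgroup D /\ index_le D n]|.

Definition residual_growth X n : nat :=
  least [set N | (0 < N)%N /\ forall g, g <> 1 -> word_ball X n g ->
    exists D, [/\ normal_subgroup D, index_le D N & ~ D g]].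

End GroupDefs.

Arguments residually_finite : clear implicits.
Arguments normal_growth : clear implicits.

(* Main.v *)
(** Put [N := F(2n)] and let [K] be the intersection of the [s(N)] normal
    subgroups of index at most [N]. The quotient by [K] embeds into the product
    of the corresponding quotients, so it has order at most [N ^ s(N)]. If [x]
    and [y] lie in the [n]-ball and agree modulo [K], then [x^-1 * y] lies in
    the [2n]-ball and in [K], hence is trivial by the choice of [N]. *)

From HB Require Import structures.
Require Import Defs.
From mathcomp Require Import all_boot all_order all_algebra all_fingroup.
From mathcomp Require Import finmap.
From mathcomp Require Import all_classical all_reals all_analysis.

Set Implicit Arguments.
Unset Strict Implicit.
Unset Printing Implicit Defensive.

Local Open Scope classical_set_scope.
Local Open Scope card_scope.
Local Open Scope group_scope.

(* A map to a finite set whose fibres form a congruence makes its image a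
   finite group; this replaces the quotient by a normal subgroup. *)
Section FiniteImage.
Variables (G : groupType) (T : finType) (f : G -> T).
Hypothesis fM : forall x x' y y',
  f x = f x' -> f y = f y' -> f (x * y) = f (x' * y').

Let im := {t : T | `[< exists x, f x = t >]}.

Let toim (x : G) : im := Sub (f x) (asboolT (ex_intro _ x erefl)).

Let rep (t : im) : G := projT1 (cid (asboolW (valP t))).

Let toimE x y : toim x = toim y <-> f x = f y.
Proof. by split=> [/(congr1 val)|fxy] //; apply: val_inj. Qed.

Let repK : cancel rep toim.
Proof.
by move=> t; apply: val_inj; rewrite /rep /=; case: cid => x /= ->.
Qed.

Let toimM x x' y y' :
  toim x = toim x' -> toim y = toim y' -> toim (x * y) = toim (x' * y').
Proof. by rewrite !toimE; apply: fM. Qed.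

Let mul (s t : im) := toim (rep s * rep t).
Let inv (s : im) := toim (rep s)^-1.

Let mulE x y : mul (toim x) (toim y) = toim (x * y).
Proof. by apply: toimM; rewrite repK. Qed.

Let mulA : associative mul.
Proof.
by move=> r s t; rewrite -(repK r) -(repK s) -(repK t) !mulE mulgA.
Qed.

Let mul1 : left_id (toim 1) mul.
Proof. by move=> s; rewrite -(repK s) mulE mul1g. Qed.

Let mulV : left_inverse (toim 1) inv mul.
Proof. by move=> s; rewrite -[X in mul _ X]repK mulE mulVg. Qed.

Lemma finite_image_group : exists (Q : finGroupType)
    (phi : {multiplicative G -> Q}),
  [/\ (#|Q| <= #|T|)%N, set_surj [set: G] [set: Q] phi
    & forall x y, phi x = phi y -> f x = f y].
Proof.
pose Q : finGroupType := HB.pack im (Finite.on im) (Finite_isGroup.Build im mulA mul1 mulV).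
have phiM : {morph (toim : G -> Q) : x y / x * y}.
  by move=> x y; apply/esym/mulE.
pose phi : {multiplicative G -> Q} :=
  HB.pack (toim : G -> Q) (isMultiplicative.Build G Q toim phiM).
exists Q, phi; split.
- exact: (leq_card (val : im -> T) val_inj).
- by move=> t _; exists (rep t) => //; apply: repK.
- by move=> x y /toimE.
Qed.

End FiniteImage.

Section CosetCodes.
Variables (G : groupType) (D : set G).
Hypothesis normD : normal_subgroup D.

Let D1 : D 1.
Proof. by have [[/set_mem]] := normD. Qed.

Let DVM x y : D x -> D y -> D (x * y^-1).
Proof.
by move=> Dx Dy; have [[_ DB] _] := normD; apply/set_mem/DB; apply/mem_set.
Qed.

Let DV x : D x -> D x^-1.
Proof. by move=> /(DVM D1); rewrite mul1g. Qed.

Let DM x y : D x -> D y -> D (x * y).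
Proof. by move=> Dx /DV/(DVM Dx); rewrite invgK. Qed.

Lemma left_coset_eq x y :
  [set x * d | d in D] = [set y * d | d in D] <-> D (x^-1 * y).
Proof.
split=> [xy|Dxy].
  have : [set y * d | d in D] y by exists 1 => //; rewrite mulg1.
  by rewrite -xy => -[d Dd <-]; rewrite mulKg.
apply/seteqP; split=> _ [d Dd <-].
  exists ((x^-1 * y)^-1 * d); first exact: DM (DV Dxy) Dd.
  by rewrite invMg invgK -!mulgA mulKVg.
by exists (x^-1 * y * d); [exact: DM | rewrite -!mulgA mulKVg].
Qed.

Lemma normal_coset_mul x x' y y' :
  D (x^-1 * x') -> D (y^-1 * y') -> D ((x * y)^-1 * (x' * y')).
Proof.
move=> Dx Dy; have [_ /(_ y _ Dx) Dxy] := normD.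
rewrite invMg -mulgA (_ : y^-1 * _ = (x^-1 * x') ^ y * (y^-1 * y')).
  exact: DM.
by rewrite /conjg -!mulgA mulKVg.
Qed.

Lemma coset_coding N : index_le D N ->
  exists c : G -> 'I_N, forall x y, c x = c y <-> D (x^-1 * y).
Proof.
move=> /pcard_leP/unsquash i.
have cosetP x : left_cosets D [set x * d | d in D] by exists x.
have ltN x : (i [set x * d | d in D]%g < N)%N.
  exact: (@funS _ _ _ _ i _ (cosetP x)).
exists (fun x => Ordinal (ltN x)) => x y; rewrite -left_coset_eq.
split=> [/(congr1 val) /= eqi|xy]; last by apply: val_inj; rewrite /= xy.
by apply: (@inj _ _ _ i) eqi; rewrite inE; apply: cosetP.
Qed.

End CosetCodes.

Lemma index_leW (G : groupType) (D : set G) M N :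
  (M <= N)%N -> index_le D M -> index_le D N.
Proof. by rewrite -card_le_II => MN DM; apply: card_le_trans DM MN. Qed.

Section Generated.
Variables (G : groupType) (X : {fset G}).

Let L := (X `|` [fset x^-1 | x in X])%fset.

Let is_wordP (w : seq G) : is_word X w -> exists v : seq L, map val v = w.
Proof.
elim: w => [|x w IHw] Xw; first by exists [::].
have [|v <-] := IHw; first by move=> y yw; apply: Xw; rewrite inE yw orbT.
have Lx : x \in L.
  rewrite /L inE; case: (Xw x (mem_head _ _)) => [->//|XVx].
  by apply/orP; right; apply/imfsetP; exists x^-1; rewrite ?invgK.
by exists ([` Lx]%fset :: v).
Qed.

Hypothesis genX : generates X.

Lemma word_lengthP g : exists w,
  [/\ is_word X w, \prod_(x <- w) x = g & size w = word_length X g].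
Proof.
have [w [Xw wg]] := genX g.
set P := [set k | exists w, [/\ is_word X w, \prod_(x <- w) x = g
  & size w = k]].
by have /leastP[] : P !=set0 by exists (size w), w.
Qed.

Lemma word_length_le w : is_word X w ->
  (word_length X (\prod_(x <- w) x) <= size w)%N.
Proof.
move=> Xw; set P := [set k | exists v, [/\ is_word X v,
  \prod_(x <- v) x = \prod_(x <- w) x & size v = k]].
have Pw : P (size w) by exists w.
by have [_] := leastP (ex_intro P _ Pw); apply.
Qed.

Lemma word_ballVM m n x y :
  word_ball X m x -> word_ball X n y -> word_ball X (m + n) (x^-1 * y).
Proof.
rewrite /word_ball /=.
have [v [Xv <- <-]] := word_lengthP x; have [w [Xw <- <-]] := word_lengthP y.
move=> vm wn; pose v' := rev (map invg v).
have -> : (\prod_(x <- v) x)^-1 * \prod_(x <- w) x = \prod_(x <- v' ++ w) x.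
  rewrite big_cat /=; congr (_ * _); rewrite /v'.
  elim: (v) => [|a u IHu]; first by rewrite !big_nil invg1.
  by rewrite /= rev_cons -cats1 big_cat big_seq1 big_cons /= invMg IHu.
apply: leq_trans (word_length_le _) _.
  move=> z; rewrite mem_cat mem_rev => /orP[/mapP[a av ->]|/Xw//].
  by rewrite invgK; have [|] := Xv a av; [right | left].
by rewrite size_cat size_rev size_map leq_add.
Qed.

Lemma word_ball_finite n : finite_set (word_ball X n).
Proof.
apply: (@sub_finite_set _ _
  ((fun v : n.-bseq L => \prod_(x <- v) (val x)) @` [set: n.-bseq L])).
  move=> g; rewrite /word_ball /=; have [w [Xw <- <-]] := word_lengthP g.
  have [v <-] := is_wordP Xw; rewrite size_map => vn.
  by exists (Bseq vn) => //=; rewrite big_map.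
exact/finite_image/finite_finset.
Qed.

(* A normal subgroup of index at most N is determined by the action of the
   letters on its cosets, numbered by 'I_N: the letters act on N points in
   finitely many ways. *)
Lemma normal_index_le_finite N :
  finite_set [set D : set G | normal_subgroup D /\ index_le D N].
Proof.
pose act (t : {ffun L * 'I_N -> 'I_N}) (v : seq L) (a : 'I_N) :=
  foldr (fun x b => t (x, b)) a v.
pose decode (p : {ffun L * 'I_N -> 'I_N} * 'I_N) : set G :=
  [set g | exists2 v : seq L, \prod_(x <- v) val x = g & act p.1 v p.2 = p.2].
apply: (@sub_finite_set _ _ (decode @` [set: _])); last first.
  exact/finite_image/finite_finset.
move=> D [normD /(coset_coding normD)[c cP]].
pose rep a := xget 1 [set g | c g = a].
pose t := [ffun p : L * 'I_N => c (val p.1 * rep p.2)].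
have repE g : c (rep (c g)) = c g.
  by rewrite /rep; case: xgetP => [x _ //|/(_ g)[]].
have tE x g : t (x, c g) = c (val x * g).
  rewrite ffunE; apply/cP; apply: normal_coset_mul => //=; last exact/cP.
  by rewrite mulVg; have [[/set_mem]] := normD.
have actE v : act t v (c 1) = c (\prod_(x <- v) val x).
  by elim: v => [|x v IHv] /=; rewrite ?big_nil // big_cons IHv tE.
have DE g : D g <-> c 1 = c g by rewrite cP invg1 mul1g.
exists (t, c 1) => //; apply/seteqP; split=> g.
  by move=> -[v <-]; rewrite /= actE => vE; apply/DE.
move=> /DE cg; have [w [Xw wg]] := genX g; have [v vw] := is_wordP Xw.
have vg : \prod_(x <- v) val x = g by rewrite -wg -vw big_map.
by exists v; rewrite //= actE vg.
Qed.

Hypothesis rfG : residually_finite G.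

Lemma residual_growthP n : (0 < residual_growth X n)%N /\
  forall g, g <> 1 -> word_ball X n g ->
    exists D, [/\ normal_subgroup D, index_le D (residual_growth X n) & ~ D g].
Proof.
set P := [set N | (0 < N)%N /\ forall g, g <> 1 -> word_ball X n g ->
    exists D, [/\ normal_subgroup D, index_le D N & ~ D g]].
suff /leastP[] : P !=set0 by [].
have sep (g : G) : exists N, g <> 1 ->
    exists D, [/\ normal_subgroup D, index_le D N & ~ D g].
  have [->|/eqP/rfG[D [nD [N /card_eqPle[DN _]] Dg]]] := eqVneq g 1.
    by exists 0.
  by exists N => _; exists D.
have [N NP] := boolp.choice sep.
exists (\max_(g <- fset_set (word_ball X n)) N g).+1; split=> // g g1 Bg.
have [D [nD DN Dg]] := NP g g1; exists D; split=> //; apply: index_leW DN.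
apply/leqW/(leq_bigmax_seq g) => //.
by rewrite in_fset_set ?inE //; apply: word_ball_finite.
Qed.

Lemma full_residual_growth_le n (N := residual_growth X (2 * n)) :
  (full_residual_growth X n <= N ^ normal_growth G N)%N.
Proof.
have [_ sepN] := residual_growthP (2 * n); rewrite -/N in sepN.
set F := fset_set [set D : set G | normal_subgroup D /\ index_le D N].
have FP D : D \in F <-> normal_subgroup D /\ index_le D N.
  by rewrite in_fset_set ?inE //; apply: normal_index_le_finite.
have coding (D : F) : exists c : G -> 'I_N,
    forall x y, c x = c y <-> (val D) (x^-1 * y).
  by have /FP[nD DN] := valP D; apply: coset_coding.
have [c cP] := boolp.choice coding.
pose f x := [ffun D : F => c D x].
have fE x y : f x = f y <-> forall D : F, (val D) (x^-1 * y).
  split=> [/ffunP fxy D|Dxy]; first by apply/cP; have := fxy D; rewrite !ffunE.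
  by apply/ffunP => D; rewrite !ffunE; apply/cP.
have fM x x' y y' : f x = f x' -> f y = f y' -> f (x * y) = f (x' * y').
  move=> /fE xx' /fE yy'; apply/fE => D.
  by apply: normal_coset_mul => //; have /FP[] := valP D.
have [Q [phi [leQ surj_phi phiE]]] := finite_image_group fM.
rewrite card_ffun card_ord -cardfE in leQ.
apply: leq_trans leQ; rewrite /full_residual_growth.
set P := (X in least X).
suff PQ : P #|Q| by have [_] := leastP (ex_intro P _ PQ); apply.
exists Q, phi; split=> // x y /set_mem Bx /set_mem By /phiE/fE Dxy.
apply: contrapT => xy.
have [||D [nD DN []]] := sepN (x^-1 * y).
- by move=> xy1; apply: xy; rewrite -[y](mulKVg x) xy1 mulg1.
- by rewrite mul2n -addnn; apply: word_ballVM.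
have DF : D \in F by apply/FP.
exact: (Dxy [` DF]%fset).
Qed.

End Generated.

Import Order.TTheory GRing.Theory Num.Theory.

Local Open Scope ring_scope.

Theorem mainTheorem10 (R : realType) (Gamma : groupType) (X : {fset Gamma})
    (rfGamma : residually_finite Gamma) (genX : generates X)
    (n : nat) (n_gt0 : (0 < n)%N) :
  ln (full_residual_growth X n)%:R <=
    (normal_growth Gamma (residual_growth X (2 * n)))%:R *
      ln (residual_growth X (2 * n))%:R :> R.
Proof.
have [N_gt0 _] := residual_growthP genX rfGamma (2 * n).
have := full_residual_growth_le genX rfGamma n.
set N := residual_growth X (2 * n) in N_gt0 *; set s := normal_growth Gamma N.
have N_pos : 0 < N%:R :> R by rewrite ltr0n.
rewrite mulr_natl -lnXn // -natrX => GN.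
have [->|] := posnP (full_residual_growth X n).
  by rewrite ln0 // ln_ge0 // ler1n expn_gt0 N_gt0.
by move=> G_gt0; rewrite ler_ln ?posrE ?ltr0n ?expn_gt0 ?N_gt0 // ler_nat.
Qed.
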